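(* Let $p\ge 3$ and $n\ge 0$ be integers, let $D$ be a $p$-angulation of an $(n+3)$-gon, and let $(m_{i,j})$ be the frieze of type $\Lambda_p$ and width $n$ corresponding to $D$. Let $v_0,\dots,v_{n+2}$ be the vertices of the associated Farey path, with indices considered modulo $n+3$. Then for all $i\in\mathbb{Z}$ and all $j$ with $-2\le j-i\le n+1$, $$m_{i,j}=d(v_{i-1},v_{j+1}),$$ where $d$ denotes the Farey distance.
   Context: A frieze of width $n$ is an array of real numbers $(m_{i,j})$, indexed by $i\in\mathbb{Z}$ and $j$ with $-2\le j-i\le n+1$, such that $m_{i,i-2}=m_{i,i+n+1}=0$, $m_{i,i-1}=m_{i,i+n}=1$, the remaining entries are positive, and the unimodular rule $m_{i,i+r}m_{i+1,i+r+1}-m_{i+1,i+r}m_{i,i+r+1}=1$ holds for all $i\in\mathbb{Z}$ and $-1\le r\le n$. The row $(m_{i,i})_{i\in\mathbb{Z}}$ is called the quiddity row; it determines the frieze via $m_{i,i+r}=m_{i,i}m_{i+1,i+r}-m_{i+2,i+r}$. A $p$-angulation $D$ of a convex regular polygon $P$ is a set of non-intersecting diagonals partitioning $P$ into a finite collection of $p$-gons. Let $P$ have $n+3$ vertices, labelled $0,1,\dots,n+2$ in cyclic order. Let $q_\alpha$ be the number of $p$-gons of $D$ incident with the vertex $\alpha$, and let $\lambda_p=2\cos(\pi/p)$. The frieze of type $\Lambda_p$ corresponding to $D$ is the frieze of width $n$ with $m_{i,i}=\lambda_p q_{i\bmod (n+3)}$ for all $i\in\mathbb{Z}$ (it is known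 that such a frieze exists and is unique). Define Möbius transformations $\xi_\alpha(z)=q_\alpha\lambda_p-\frac1z$ for $0\le\alpha\le n+2$, and the vertices of the associated Farey path by $v_0=\infty$ and $v_\alpha=\xi_0\xi_1\cdots\xi_{\alpha-1}(\infty)$ (composition of maps) for $1\le\alpha\le n+2$. Each vertex is written as a fraction $v_\alpha=\frac{a_\alpha}{b_\alpha}$ with numerator $a_\alpha=m_{0,\alpha-1}$ and denominator $b_\alpha=m_{1,\alpha-1}$ for $0\le\alpha\le n+2$ (with $\frac10=\infty$). The Farey distance of two vertices is $d(v_i,v_j)=|a_ib_j-a_jb_i|$. *)

(* Defs.v *)
From HB Require Import structures.
From mathcomp Require Import all_boot all_order all_algebra.
From mathcomp Require Import reals trigo.
From mathcomp Require Import ring lra zify.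

Set Implicit Arguments.
Unset Strict Implicit.
Unset Printing Implicit Defensive.

Import Order.TTheory GRing.Theory Num.Theory.
Local Open Scope ring_scope.

(* A frieze of width n.  Arrays are total functions of (i, j), but only the    *)
(* entries in the strip -2 <= j - i <= n + 1 are constrained or ever used.     *)
Definition frieze (R : realType) (n : nat) (m : int -> int -> R) : Prop :=
  [/\ forall i : int, m i (i - 2) = 0 /\ m i (i + n%:Z + 1) = 0,
      forall i : int, m i (i - 1) = 1 /\ m i (i + n%:Z) = 1,
      forall i j : int, 0 <= j - i < n%:Z -> 0 < m i j
    & forall i r : int, -1 <= r <= n%:Z ->
        m i (i + r) * m (i + 1) (i + r + 1)
        - m (i + 1) (i + r) * m i (i + r + 1) = 1].

(* Dissections of the polygon whose vertices are 0, ..., n + 2 in cyclic order *)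
(* are described combinatorially: a segment joining two vertices is the        *)
(* unordered pair of its endpoints, and a convex subpolygon is its vertex set. *)
Section Dissection.
Variable n : nat.
Implicit Types (a b c d : 'I_n.+3) (e f : {set 'I_n.+3}).
Implicit Types (D : {set {set 'I_n.+3}}) (S : {set 'I_n.+3}).

Definition side a b : bool := (b == ordS a) || (a == ordS b).

Definition diagonal e : bool :=
  [exists a, exists b, [&& e == [set a; b], a != b & ~~ side a b]].

(* Two diagonals meet inside the polygon iff their endpoints interleave; the   *)
(* relation is used symmetrically, so only one of the two orders is listed.    *)
Definition crosses e f : bool :=
  [exists a, exists b, exists c, exists d,
    [&& e == [set a; b], f == [set c; d] & (a < c < b)%N && (b < d)%N]].

(* Going round the polygon from a, one meets b strictly before c. *)
Definition cyclic a b c : bool :=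
  [|| (a < b < c)%N, (b < c < a)%N | (c < a < b)%N].

(* b follows a on the boundary of the subpolygon with vertex set S. *)
Definition next_in S a b : bool :=
  [&& a \in S, b \in S, a != b & [forall c in S, ~~ cyclic a c b]].

(* The pieces into which a non-crossing set D of diagonals cuts the polygon:   *)
(* the subpolygons whose edges are sides or members of D, and which are not    *)
(* cut further, i.e. none of whose own diagonals is in D.                      *)
Definition cell D S : bool :=
  (3 <= #|S|)%N &&
  [forall a in S, forall b in S, (a != b) ==>
     if next_in S a b || next_in S b a
     then side a b || ([set a; b] \in D)
     else [set a; b] \notin D].

Definition p_angulation (p : nat) D : Prop :=
  [/\ forall e, e \in D -> diagonal e,
      forall e f, e \in D -> f \in D -> ~~ crosses e f
    & forall S, cell D S -> #|S| = p].

Definition q_at D a : nat := #|[set S | cell D S & a \in S]|.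

Definition vertex_mod (k : int) : 'I_n.+3 := inord `|(k %% n.+3%:Z)%Z|%N.

End Dissection.

Arguments vertex_mod : clear implicits.

Definition lambda (R : realType) (p : nat) : R := 2 * cos (pi / p%:R).

Definition frieze_of (R : realType) (p n : nat) (D : {set {set 'I_n.+3}})
    (m : int -> int -> R) : Prop :=
  frieze n m /\
  forall i : int, m i i = lambda R p * (q_at D (vertex_mod n i))%:R.

(* The real projective line R u {oo} is option R, with None as oo. *)
Definition fraction (R : realType) (a b : R) : option R :=
  if b == 0 then None else Some (a / b).

(* The Moebius map z |-> c - 1/z, with oo |-> c and 0 |-> oo. *)
Definition moebius (R : realType) (c : R) (z : option R) : option R :=
  if z is Some x then (if x == 0 then None else Some (c - x^-1)) else Some c.

Definition xi (R : realType) (p n : nat) (D : {set {set 'I_n.+3}})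
    (a : 'I_n.+3) : option R -> option R :=
  moebius ((q_at D a)%:R * lambda R p).

(* xi_0 \o xi_1 \o ... \o xi_(a-1) applied to oo. *)
Definition path_point (R : realType) (p n : nat) (D : {set {set 'I_n.+3}})
    (a : 'I_n.+3) : option R :=
  (\big[(fun f g : option R -> option R => f \o g)/id]_(b < n.+3 | (b < a)%N)
     xi p D b) None.

(* A vertex is a point of R u {oo} together with a way of writing it as a      *)
(* fraction; the Farey distance depends on that fraction.                      *)
Record vertex (R : realType) := Vertex {
  point : option R;
  num : R;
  den : R;
  vertexP : ((num != 0) || (den != 0)) /\ point = fraction num den }.

Definition farey_dist (R : realType) (v w : vertex R) : R :=
  `|num v * den w - num w * den v|.

Section FareyPath.
Variables (R : realType) (n : nat) (m : int -> int -> R).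
Hypothesis fm : frieze n m.

Lemma frieze_neq0 (i j : int) : -1 <= j - i <= n%:Z -> m i j != 0.
Proof.
have [_ m1 mpos _] := fm => hij.
have [e|e1] := eqVneq j (i - 1); first by rewrite e (m1 i).1 oner_neq0.
have [e|e2] := eqVneq j (i + n%:Z); first by rewrite e (m1 i).2 oner_neq0.
by rewrite gt_eqF// mpos//; lia.
Qed.

Lemma frieze_rec (i : int) (r : nat) : (r <= n.+1)%N ->
  m i (i + r%:Z) = m i i * m (i + 1) (i + r%:Z) - m (i + 2) (i + r%:Z).
Proof.
have [m0 m1 _ uni] := fm.
elim: r => [_|r IH rn].
  have := (m1 (i + 1)).1; have := (m0 (i + 2)).1.
  by rewrite !addrK !addr0 => -> ->; rewrite mulr1 subr0.
have Y0 : m (i + 1) (i + r%:Z) != 0 by apply: frieze_neq0; lia.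
have U1 := uni i r%:Z ltac:(lia).
have U2 := uni (i + 1) (r%:Z - 1) ltac:(lia).
move: U2; have -> : i + 1 + (r%:Z - 1) = i + r%:Z by lia.
have -> : i + 1 + 1 = i + 2 :> int by lia.
move=> U2.
have -> : i + r.+1%:Z = i + r%:Z + 1 by lia.
apply: (mulfI Y0); rewrite IH in U1; last by lia.
move: U1 U2; move: (m _ _) (m _ _) (m _ _) (m _ _) (m _ _) (m _ _).
by move=> x y z t u v *; lra.
Qed.

Lemma fraction_path (k : nat) (i : int) : (k <= n.+2)%N ->
  (\big[(fun f g : option R -> option R => f \o g)/id]_(l < k)
     moebius (m (i + l%:Z) (i + l%:Z))) None
  = fraction (m i (i + k%:Z - 1)) (m (i + 1) (i + k%:Z - 1)).
Proof.
have [m0 m1 _ _] := fm.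
elim: k i => [|k IH] i kn.
  have := (m0 (i + 1)).1; have -> : i + 1 - 2 = i - 1 :> int by lia.
  by rewrite big_ord0 /= addr0 /fraction => ->; rewrite eqxx.
rewrite big_ord_recl /= addr0.
under eq_bigr => l _.
  have -> : i + (bump 0 l)%:Z = (i + 1) + l%:Z by rewrite /bump; lia.
over.
rewrite IH; last by lia.
have -> : i + 1 + k%:Z - 1 = i + k%:Z by lia.
have -> : i + k.+1%:Z - 1 = i + k%:Z by lia.
have -> : i + 1 + 1 = i + 2 :> int by lia.
rewrite (@frieze_rec i k); last by lia.
rewrite /fraction; case: ifPn => [/eqP Z0|Z0] /=.
  have Y0 : m (i + 1) (i + k%:Z) != 0.
    apply/eqP => Y0; case: k kn {IH} Y0 Z0 => [|k] kn Y0 Z0.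
      have := (m1 (i + 1)).1; rewrite addrK => e; move: Y0.
      by rewrite addr0 e => /eqP; rewrite oner_eq0.
    have := @frieze_neq0 (i + 1) (i + k.+1%:Z) ltac:(lia).
    by rewrite Y0 eqxx.
  by rewrite (negbTE Y0) Z0 subr0 mulfK.
rewrite mulf_eq0 invr_eq0 (negbTE Z0) orbF; case: ifPn => // Y0.
by congr Some; field; rewrite Y0 Z0.
Qed.

End FareyPath.

Lemma farey_pathP (R : realType) (p n : nat) (D : {set {set 'I_n.+3}})
    (m : int -> int -> R) (hm : frieze_of p D m) (a : 'I_n.+3) :
  ((m 0 (a%:Z - 1) != 0) || (m 1 (a%:Z - 1) != 0)) /\
  path_point R p D a = fraction (m 0 (a%:Z - 1)) (m 1 (a%:Z - 1)).
Proof.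
case: hm => fm mq; have an := ltn_ord a; split.
  have [e|e] := eqVneq (val a) n.+2.
    by rewrite (@frieze_neq0 R n m fm 1) ?orbT//; move: e => /=; lia.
  by rewrite (@frieze_neq0 R n m fm 0)//; move: e => /=; lia.
have := @fraction_path R n m fm a 0 ltac:(lia).
rewrite !add0r => <-; rewrite /path_point.
rewrite (big_ord_narrow (ltnW an)).
apply: (f_equal (fun h : option R -> option R => h None)).
apply: eq_bigr => l _; rewrite /xi; congr (moebius _).
rewrite add0r mq mulrC; congr (_ * (q_at D _)%:R).
apply: val_inj; rewrite /= /vertex_mod modz_small; last first.
  by have := ltn_ord l; lia.
by rewrite inordK//; exact: ltn_trans (ltn_ord l) an.
Qed.

Definition farey_path (R : realType) (p n : nat) (D : {set {set 'I_n.+3}})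
    (m : int -> int -> R) (hm : frieze_of p D m) (a : 'I_n.+3) : vertex R :=
  Vertex (farey_pathP hm a).

(* Main.v *)
Require Import Defs.
From mathcomp Require Import all_boot all_order all_algebra.
From mathcomp Require Import reals.
From mathcomp Require Import lra zify.
Import Order.TTheory GRing.Theory Num.Theory.
Local Open Scope ring_scope.

(** For 0 <= s <= t <= n + 2 the determinant a_s b_t - a_t b_s equals m_{s+1,t-1}:
both sides satisfy the same three-term recurrence in t, with coefficients the
quiddity row, and they agree at t = s and t = s + 1.  For general indices one
moves (i, j) into this range with the glide symmetry m_{i,j} = m_{j+2,i+n+1},
which holds because the quiddity row is (n+3)-periodic: both sides, as
functions of i, solve the same recurrence.  Applied twice, the glide symmetry
gives the (n+3)-periodicity of the frieze. *)

(** Serves to drop the absolute value in the Farey distance, boundary zeros included. *)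
Lemma frieze_ge0 {R : realType} {n : nat} {m : int -> int -> R} (fm : frieze n m)
    (i j : int) : -2 <= j - i <= n%:Z + 1 -> 0 <= m i j.
Proof.
have [m0 m1 mpos _] := fm => hij.
have [->|e1] := eqVneq j (i - 2); first by rewrite (m0 i).1.
have [->|e2] := eqVneq j (i + n%:Z + 1); first by rewrite (m0 i).2.
have [->|e3] := eqVneq j (i - 1); first by rewrite (m1 i).1.
have [->|e4] := eqVneq j (i + n%:Z); first by rewrite (m1 i).2.
by apply/ltW/mpos; lia.
Qed.

(** Mirror image of [frieze_rec], with the column moving instead of the row. Two adjacent unimodular
    relations share the entry $m_{j-r,j-1}$, which is nonzero and can be cancelled. *)
Lemma frieze_rec_col {R : realType} {n : nat} {m : int -> int -> R} (fm : frieze n m)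
    (j : int) (r : nat) : (r <= n.+1)%N ->
  m (j - r%:Z) j = m (j - r%:Z) (j - 1) * m j j - m (j - r%:Z) (j - 2).
Proof.
have [m0 m1 _ uni] := fm.
elim: r => [_|r IH rn].
  by rewrite subr0 (m1 j).1 (m0 j).1 mul1r subr0.
have Y0 : m (j - r%:Z) (j - 1) != 0 by apply: (frieze_neq0 fm); lia.
have -> : j - r.+1%:Z = j - r%:Z - 1 by lia.
have := uni (j - r%:Z - 1) r%:Z ltac:(lia).
have := uni (j - r%:Z - 1) (r%:Z - 1) ltac:(lia).
have -> : j - r%:Z - 1 + r%:Z = j - 1 by lia.
have -> : j - r%:Z - 1 + (r%:Z - 1) = j - 2 by lia.
have -> : j - 2 + 1 = j - 1 by lia.
rewrite !subrK IH; last by lia.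
move=> U2 U1; apply: (mulfI Y0); move: U1 U2.
move: (m _ _) (m _ _) (m _ _) (m _ _) (m _ _) (m _ _).
by move=> x y z t u v *; lra.
Qed.

Lemma frieze_det {R : realType} {n : nat} {m : int -> int -> R} (fm : frieze n m)
    (s k : nat) : (s + k <= n.+2)%N ->
  m 0 (s%:Z - 1) * m 1 (s%:Z + k%:Z - 1) - m 0 (s%:Z + k%:Z - 1) * m 1 (s%:Z - 1)
  = m (s%:Z + 1) (s%:Z + k%:Z - 1).
Proof.
have [m0 m1 _ uni] := fm.
elim/ltn_ind: k => -[|[|k]] IH hk.
- have := (m0 (s%:Z + 1)).1; have -> : s%:Z + 1 - 2 = s%:Z - 1 :> int by lia.
  by rewrite addr0 => ->; rewrite mulrC subrr.
(* For $k = 1$ the determinant is the unimodular rule between rows 0 and 1. *)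
- have := (m1 (s%:Z + 1)).1; rewrite !addrK => ->.
  have := uni 0 (s%:Z - 1) ltac:(lia); rewrite !add0r subrK.
  by rewrite [X in _ - X]mulrC.
have I1 := IH k.+1 ltac:(lia) ltac:(lia).
have I2 := IH k ltac:(lia) ltac:(lia).
(* Rows 0, 1 and $s+1$ obey this recurrence with one and the same coefficient, so it passes to the
   determinant by linearity. *)
have rec (i : int) : 0 <= i <= s%:Z + 1 ->
    m i (s%:Z + k.+2%:Z - 1) = m i (s%:Z + k.+1%:Z - 1)
      * m (s%:Z + k.+2%:Z - 1) (s%:Z + k.+2%:Z - 1) - m i (s%:Z + k%:Z - 1).
  move=> hi; have := frieze_rec_col fm (s%:Z + k.+2%:Z - 1)
    `|(s%:Z + k.+2%:Z - 1 - i)%R|%N ltac:(lia).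
  have -> : s%:Z + k.+2%:Z - 1 - `|(s%:Z + k.+2%:Z - 1 - i)%R|%N%:Z = i by lia.
  have -> : s%:Z + k.+2%:Z - 1 - 1 = s%:Z + k.+1%:Z - 1 by lia.
  by have -> : s%:Z + k.+2%:Z - 1 - 2 = s%:Z + k%:Z - 1 by lia.
rewrite (rec 0) ?(rec 1) ?(rec (s%:Z + 1)) -?I1 -?I2; try lia.
move: (m _ _) (m _ _) (m _ _) (m _ _) (m _ _) (m _ _) (m _ _).
by move=> *; lra.
Qed.

Lemma frieze_glide {R : realType} {n : nat} {m : int -> int -> R} (fm : frieze n m)
    (per : forall i : int, m (i + n.+3%:Z) (i + n.+3%:Z) = m i i) (i j : int) :
  -2 <= j - i <= n%:Z + 1 -> m i j = m (j + 2) (i + n%:Z + 1).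
Proof.
have [m0 m1 _ _] := fm => hij.
(* Fix $j$ and put $i = j-n-1+k$; the values $k = 0$ and $k = 1$ lie on the boundary rows of zeros
   and ones. *)
suff glide k : (k <= n.+3)%N ->
    m (j - n%:Z - 1 + k%:Z) j = m (j + 2) (j + k%:Z).
  have := glide `|(i - (j - n%:Z - 1))%R|%N ltac:(lia).
  have -> : j - n%:Z - 1 + `|(i - (j - n%:Z - 1))%R|%N%:Z = i by lia.
  by have -> : j + `|(i - (j - n%:Z - 1))%R|%N%:Z = i + n%:Z + 1 by lia.
elim/ltn_ind: k => -[|[|k]] IH hk.
- have := (m0 (j - n%:Z - 1)).2; have := (m0 (j + 2)).1.
  have -> : j - n%:Z - 1 + n%:Z + 1 = j by lia.
  by rewrite addrK !addr0 => -> ->.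
- have := (m1 (j - n%:Z)).2; have := (m1 (j + 2)).1.
  rewrite !subrK; have -> : j + 2 - 1 = j + 1 :> int by lia.
  by move=> -> ->.
have I0 := IH k ltac:(lia) ltac:(lia).
have I1 := IH k.+1 ltac:(lia) ltac:(lia).
have := frieze_rec_col fm (j + k.+2%:Z) k ltac:(lia).
have -> : j + k.+2%:Z - k%:Z = j + 2 by lia.
have -> : j + k.+2%:Z - 1 = j + k.+1%:Z by lia.
have -> : j + k.+2%:Z - 2 = j + k%:Z by lia.
have := frieze_rec fm (j - n%:Z - 1 + k%:Z) (leq_subr k n.+1).
(* The row and the column recurrence have their coefficients at diagonal positions $n+3$ apart,
   which periodicity identifies. *)
have := per (j - n%:Z - 1 + k%:Z).
have -> : j - n%:Z - 1 + k%:Z + n.+3%:Z = j + k.+2%:Z by lia.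
have -> : j - n%:Z - 1 + k%:Z + (n.+1 - k)%N%:Z = j by lia.
have -> : j - n%:Z - 1 + k%:Z + 1 = j - n%:Z - 1 + k.+1%:Z by lia.
have -> : j - n%:Z - 1 + k%:Z + 2 = j - n%:Z - 1 + k.+2%:Z by lia.
by move=> ->; rewrite I0 I1; lra.
Qed.

Lemma vertex_modE (n : nat) (k : int) :
  (vertex_mod n k : nat)%:Z = (k %% n.+3%:Z)%Z.
Proof. by rewrite /vertex_mod inordK; lia. Qed.

Lemma quiddity_periodic {R : realType} {p n : nat} {D : {set {set 'I_n.+3}}}
    {m : int -> int -> R} (hm : frieze_of p D m) (i : int) :
  m (i + n.+3%:Z) (i + n.+3%:Z) = m i i.
Proof. by rewrite !hm.2 /vertex_mod modzDr. Qed.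

Lemma frieze_shift {R : realType} {n : nat} {m : int -> int -> R} (fm : frieze n m)
    (per : forall i : int, m (i + n.+3%:Z) (i + n.+3%:Z) = m i i) (q i j : int) :
  -2 <= j - i <= n%:Z + 1 -> m (i + q * n.+3%:Z) (j + q * n.+3%:Z) = m i j.
Proof.
have step (a b : int) : -2 <= b - a <= n%:Z + 1 -> m (a + n.+3%:Z) (b + n.+3%:Z) = m a b.
  move=> hab; rewrite (frieze_glide fm per _ _ hab).
  rewrite (frieze_glide fm per (b + 2)); last by lia.
  by congr (m _ _); lia.
move=> hij; elim/int_ind: q => [|k IH|k IH]; first by rewrite mul0r !addr0.
  by rewrite -IH -[RHS]step; [congr (m _ _); lia|lia].
by rewrite -IH -[LHS]step; [congr (m _ _); lia|lia].
Qed.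

Theorem proposition18 (R : realType) (p n : nat) (hp : (3 <= p)%N)
    (D : {set {set 'I_n.+3}}) (hD : p_angulation p D)
    (m : int -> int -> R) (hm : frieze_of p D m)
    (i j : int) (hij : -2 <= j - i <= n%:Z + 1) :
  m i j = farey_dist (farey_path hm (vertex_mod n (i - 1)))
                     (farey_path hm (vertex_mod n (j + 1))).
Proof.
have fm := hm.1; have per := quiddity_periodic hm.
rewrite /farey_dist /=.
have := vertex_modE n (i - 1); have := vertex_modE n (j + 1).
have := ltn_ord (vertex_mod n (i - 1)); have := ltn_ord (vertex_mod n (j + 1)).
move: (nat_of_ord (vertex_mod n (i - 1))) (nat_of_ord (vertex_mod n (j + 1))).
move=> s t tn sn et es.
have := divz_eq (j + 1) n.+3%:Z; have := divz_eq (i - 1) n.+3%:Z.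
rewrite -et -es; move: (_ %/ _)%Z (_ %/ _)%Z => b a ei ej.
(* Now $i-1 = a(n+3)+s$ and $j+1 = b(n+3)+t$, with difference between 0 and $n+3$. Hence $b = a$ or
   $b = a+1$, and for $s < t$ only $b = a$ is possible. *)
have [st|ts] := leqP s t.
  have := frieze_det fm s (t - s)%N ltac:(lia).
  have -> : s%:Z + (t - s)%N%:Z - 1 = t%:Z - 1 by lia.
  move=> ->; rewrite ger0_norm; last by apply: (frieze_ge0 fm); lia.
  have [ab|ab] := eqVneq a b.
    rewrite -[RHS](frieze_shift fm per a); last by lia.
    by congr (m _ _); lia.
  (* Here [j = i + n + 1], so that both entries vanish. *)
  have -> : j = i + n%:Z + 1 by nia.
  have -> : t%:Z - 1 = s%:Z + 1 - 2 :> int by nia.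
  by case: fm => m0 _ _ _; rewrite (m0 i).2 (m0 _).1.
have := frieze_det fm t (s - t)%N ltac:(lia).
have -> : t%:Z + (s - t)%N%:Z - 1 = s%:Z - 1 by lia.
rewrite distrC => ->; rewrite ger0_norm; last by apply: (frieze_ge0 fm); lia.
(* The glide turns $m_{t+1,s-1}$ into $m_{s+1,t+n+2}$, which is $m_{i,j}$ moved back by $a$
   periods. *)
rewrite (frieze_glide fm per (t%:Z + 1)); last by lia.
have ab : b = a + 1 by nia.
rewrite -[RHS](frieze_shift fm per a); last by lia.
by congr (m _ _); lia.
Qed.
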